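(* Assume (H0) and (H1). Let $u(t,x)$ be the viscosity solution of the problem $u_t+H(D_xu)=0$ in $\Omega=(0,T)\times\mathbb{R}^n$, $u(0,x)=\sigma(x)$ for $x\in\mathbb{R}^n$, defined by the Hopf-Lax formula $u(t,x)=\min_{y\in\mathbb{R}^n}\{\sigma(y)+tH^*(\frac{x-y}{t})\}$. Suppose that there exists $t_*\in(0,T)$ such that the mapping $y\mapsto x(t_*,y)=y+t_*H_p(\sigma_y(y))$ is injective. Then $u(t,x)$ is continuously differentiable on the open strip $(0,t_* )\times\mathbb{R}^n$.
   Context: Let $T>0$, $H:\mathbb{R}^n\to\mathbb{R}$, $\sigma:\mathbb{R}^n\to\mathbb{R}$. $H^*(z)=\max_{y\in\mathbb{R}^n}\{\langle z,y\rangle-H(y)\}$ is the Fenchel conjugate of $H$; $H_p$ and $\sigma_y$ denote the gradients of $H$ and $\sigma$. (H0): $H$ is strictly convex on $\mathbb{R}^n$ and superlinear, i.e. $\lim_{\|p\|\to\infty}H(p)/\|p\|=+\infty$. (H1): $\sigma$ is continuous on $\mathbb{R}^n$ and for every $(t_0,x_0)\in[0,T)\times\mathbb{R}^n$ there exist constants $r,N>0$ such that $\min_{\|y\|\le N}\{\sigma(y)+tH^*(\frac{x-y}{t})\}<\sigma(z)+tH^*(\frac{x-z}{t})$ whenever $\|z\|>N$, $t\in(0,T)$ and $|t-t_0|+\|x-x_0\|<r$. *)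

(* Defs.v *)
From mathcomp Require Import all_boot all_order all_algebra.
From mathcomp Require Import all_classical all_reals all_analysis.
Import Order.TTheory GRing.Theory Num.Theory.
Import numFieldNormedType.Exports.

Set Implicit Arguments.
Unset Strict Implicit.
Unset Printing Implicit Defensive.

Local Open Scope classical_set_scope.
Local Open Scope ring_scope.

Definition dot (R : realType) (n : nat) (x y : 'rV[R]_n) : R :=
  \sum_(i < n) x 0 i * y 0 i.

(* The library norm on row vectors is the sup norm; this one is Euclidean. *)
Definition enorm (R : realType) (n : nat) (x : 'rV[R]_n) : R :=
  Num.sqrt (dot x x).

(* Greatest and least elements; the value is 0 if the extremum is not
   attained. *)
Definition set_max (R : realType) (A : set R) : R := xget 0 (A `&` ubound A).
Definition set_min (R : realType) (A : set R) : R := xget 0 (A `&` lbound A).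

Definition grad (R : realType) (n : nat) (f : 'rV[R]_n -> R) (x : 'rV[R]_n) :
    'rV[R]_n :=
  \row_(i < n) 'D_(delta_mx 0 i) f x.

(* In finite dimension, continuity of p |-> 'd f p v for each fixed v amounts
   to continuity of p |-> 'd f p in operator norm. D is meant to be open. *)
Definition continuously_differentiable_on (R : realType)
    (V : normedModType R) (D : set V) (f : V -> R) : Prop :=
  (forall p, D p -> differentiable f p) /\
  (forall v : V, {in D, continuous (fun p => 'd f p v : R)}).

Definition strictly_convex (R : realType) (n : nat) (H : 'rV[R]_n -> R) : Prop :=
  forall (x y : 'rV[R]_n) (a : R), x != y -> 0 < a < 1 ->
    H (a *: x + (1 - a) *: y) < a * H x + (1 - a) * H y.

Definition superlinear (R : realType) (n : nat) (H : 'rV[R]_n -> R) : Prop :=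
  forall A : R, exists B : R, forall p : 'rV[R]_n,
    B < enorm p -> A < H p / enorm p.

Definition hypH0 (R : realType) (n : nat) (H : 'rV[R]_n -> R) : Prop :=
  strictly_convex H /\ superlinear H.

Definition fenchel (R : realType) (n : nat) (H : 'rV[R]_n -> R)
    (z : 'rV[R]_n) : R :=
  set_max (range (fun y : 'rV[R]_n => dot z y - H y)).

Definition hopf_lax_cost (R : realType) (n : nat) (H sigma : 'rV[R]_n -> R)
    (t : R) (x y : 'rV[R]_n) : R :=
  sigma y + t * fenchel H (t^-1 *: (x - y)).

Definition hopf_lax (R : realType) (n : nat) (H sigma : 'rV[R]_n -> R)
    (t : R) (x : 'rV[R]_n) : R :=
  set_min (range (hopf_lax_cost H sigma t x)).

Definition hypH1 (R : realType) (n : nat) (T : R) (H sigma : 'rV[R]_n -> R) :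
    Prop :=
  continuous sigma /\
  forall (t0 : R) (x0 : 'rV[R]_n), 0 <= t0 < T ->
    exists r N : R, [/\ 0 < r, 0 < N &
      forall (t : R) (x z : 'rV[R]_n),
        N < enorm z -> 0 < t < T -> `|t - t0| + enorm (x - x0) < r ->
        set_min (hopf_lax_cost H sigma t x @` [set y | enorm y <= N])
          < hopf_lax_cost H sigma t x z].

Definition strip (R : realType) (n : nat) (T : R) : set (R * 'rV[R]_n) :=
  [set p | 0 < p.1 < T].
Arguments strip {R} n T.

(* phi_t + H (D_x phi) at the point p = (t, x) *)
Definition hj_operator (R : realType) (n : nat) (H : 'rV[R]_n -> R)
    (phi : R * 'rV[R]_n -> R) (p : R * 'rV[R]_n) : R :=
  'D_1 (fun t : R => phi (t, p.2)) p.1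
    + H (grad (fun x : 'rV[R]_n => phi (p.1, x)) p.2).

(* Crandall-Lions viscosity solution of u_t + H (D_x u) = 0 on the strip,
   continuous up to t = 0, with u (0, x) = sigma x. *)
Definition viscosity_solution (R : realType) (n : nat) (T : R)
    (H sigma : 'rV[R]_n -> R) (u : R * 'rV[R]_n -> R) : Prop :=
  [/\ {within [set p : R * 'rV[R]_n | 0 <= p.1 < T], continuous u},
      forall x : 'rV[R]_n, u (0, x) = sigma x,
      forall (phi : R * 'rV[R]_n -> R) (p : R * 'rV[R]_n),
        continuously_differentiable_on (strip n T) phi -> strip n T p ->
        (\forall q \near p, u q - phi q <= u p - phi p) ->
        hj_operator H phi p <= 0 &
      forall (phi : R * 'rV[R]_n -> R) (p : R * 'rV[R]_n),
        continuously_differentiable_on (strip n T) phi -> strip n T p ->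
        (\forall q \near p, u p - phi p <= u q - phi q) ->
        0 <= hj_operator H phi p].

(* Main.v *)
Require Import Defs.
From HB Require Import structures.
From mathcomp Require Import all_boot all_order all_algebra.
From mathcomp Require Import all_classical all_reals all_analysis.
From mathcomp Require Import ring lra.
Import Order.TTheory GRing.Theory Num.Theory.
Import numFieldNormedType.Exports.

Set Implicit Arguments.
Unset Strict Implicit.
Unset Printing Implicit Defensive.

Local Open Scope classical_set_scope.
Local Open Scope ring_scope.

(** Why the theorem holds.  Write L for the Fenchel conjugate of H, and call y
    a foot of (t, x) if it minimises y |-> sigma y + t L ((x - y) / t).

    At a foot the first-order condition reads
    grad sigma y = grad L ((x - y) / t), and grad L inverts grad H, so
    x = y + t H_p (sigma_y y): the characteristic from y passes through (t, x)
    ([minimiser_characteristic]).  At time tstar every point has a foot, so the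
    map y |-> x (tstar, y) is onto; being injective, it is a bijection and every
    y is the unique foot of x (tstar, y).  Thus every characteristic is optimal up to time tstar
    ([characteristic_optimal]).

    Now let y and z be two feet of (t, x) with t < tstar.  Prolong the
    characteristic of y from (t, x) to the point at time tstar.  Since
    (t, w) |-> t L (w / t) is subadditive, using z instead of y up to time t
    costs no more, so z is a foot of that later point as well
    ([minimiser_persists]); hence z = y ([minimiser_unique]).

    Finally u is a minimum over y of functions that are C1 in (t, x).  As feet
    are unique and, by (H1), locally confined to a compact ball, the foot is a
    continuous function of (t, x) ([continuous_argmin]).  Comparing the feet of
    two points q and a squeezes u q - u a between two linear forms in q - a
    whose coefficients both tend to (- H p, p), where p = grad L ((x - y) / t)
    at a; hence u is differentiable with that differential
    ([diff_of_sandwich]), and the formula is continuous in a. *)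

(** * Continuity of minimisers *)

(** For each y in K other than m a, the strict inequality at (a, y) persists on
    a product of neighbourhoods, so that y and its neighbours are excluded as
    minimisers for parameters near a.  Compactness, in the form of near
    coverings, makes one neighbourhood of a serve for all of K outside V. *)
Lemma continuous_argmin (R : realType) (P Y : topologicalType) (f : P * Y -> R)
    (K : set Y) (m : P -> Y) (a : P) :
  compact K -> {for (a, m a), continuous f} ->
  (forall y, K y -> {for (a, y), continuous f}) ->
  (forall y, K y -> y <> m a -> f (a, m a) < f (a, y)) ->
  (\forall q \near a, K (m q) /\ f (q, m q) <= f (q, m a)) ->
  {for a, continuous m}.
Proof.
move=> /compact_near_coveringP cK fma fc munique mmin V Vma.
rewrite nbhs_filterE /=.
have cov : \forall q \near a,
    K `<=` (fun y => f (q, m a) < f (q, y) \/ V y).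
  apply: cK => y Ky.
  have [->|/eqP yma] := eqVneq y (m a).
    exists (V, setT) => /=; first by split => //; exact: filterT.
    by move=> [y' q] [/= ? _]; right.
  (* a level separating the two values, so that each side can vary on its own *)
  pose e := (f (a, m a) + f (a, y)) / 2.
  have lt_ma_y := munique _ Ky yma.
  have near_ma : \forall q \near a, f (q, m a) < e.
    have : (fun q => f (q, m a)) @ a --> f (a, m a).
      by apply: (continuous_comp (f := fun q => (q, m a)) (g := f));
        [apply: cvg_pair; [exact: cvg_id|exact: cvg_cst]|exact: fma].
    by move=> /cvgr_lt; apply; rewrite /e; lra.
  have near_y : \forall q \near (a, y), e < f q.
    by have /cvgr_gt := fc y Ky; apply; rewrite /e; lra.
  case: near_y => -[A B] /= [Aa By] AB.
  exists (B, A `&` (fun q => f (q, m a) < e)) => /=.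
    by split => //; exact: filterI.
  move=> [y' q] /= [By' [Aq lt_e]]; left; apply: (lt_trans lt_e).
  exact: (AB (q, y')).
near=> q.
have [Kmq min_q] : K (m q) /\ f (q, m q) <= f (q, m a) by near: q.
have Hq : K `<=` (fun y => f (q, m a) < f (q, y) \/ V y) by near: q.
by case: (Hq _ Kmq) => // /(le_lt_trans min_q); rewrite ltxx.
Unshelve. all: by end_near. Qed.

(** * The Euclidean product and norm *)

Lemma dotDl (R : realType) n (x y z : 'rV[R]_n) :
  dot (x + y) z = dot x z + dot y z.
Proof. by rewrite -big_split; apply: eq_bigr => i _; rewrite mxE mulrDl. Qed.

Lemma dotDr (R : realType) n (x y z : 'rV[R]_n) :
  dot x (y + z) = dot x y + dot x z.
Proof. by rewrite -big_split; apply: eq_bigr => i _; rewrite mxE mulrDr. Qed.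

Lemma dotZr (R : realType) n a (x y : 'rV[R]_n) :
  dot x (a *: y) = a * dot x y.
Proof. by rewrite mulr_sumr; apply: eq_bigr => i _; rewrite mxE mulrCA. Qed.

Lemma dotC (R : realType) n (x y : 'rV[R]_n) : dot x y = dot y x.
Proof. by apply: eq_bigr => i _; rewrite mulrC. Qed.

Lemma dotZl (R : realType) n a (x y : 'rV[R]_n) :
  dot (a *: x) y = a * dot x y.
Proof. by rewrite dotC dotZr dotC. Qed.

Lemma dotNr (R : realType) n (x y : 'rV[R]_n) : dot x (- y) = - dot x y.
Proof. by rewrite -scaleN1r dotZr mulN1r. Qed.

Lemma dotBr (R : realType) n (x y z : 'rV[R]_n) :
  dot x (y - z) = dot x y - dot x z.
Proof. by rewrite dotDr dotNr. Qed.

Lemma dot0r (R : realType) n (x : 'rV[R]_n) : dot x 0 = 0.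
Proof. by rewrite -(scale0r 0) dotZr mul0r. Qed.

Lemma dot_delta (R : realType) n (x : 'rV[R]_n) i :
  dot x (delta_mx 0 i) = x 0 i.
Proof.
rewrite /dot (bigD1 i)//= mxE !eqxx mulr1 big1 ?addr0// => j ji.
by rewrite mxE (negbTE ji) andbF mulr0.
Qed.

Lemma ler_coord_norm (R : realType) n (x : 'rV[R]_n) i : `|x 0 i| <= `|x|.
Proof.
rewrite [leRHS]/Num.Def.normr/= mx_normrE; apply/bigmax_geP; right => /=.
by exists (0, i).
Qed.

Lemma ler_norm_enorm (R : realType) n (x : 'rV[R]_n) : `|x| <= enorm x.
Proof.
rewrite [leLHS]/Num.Def.normr/= mx_normrE; apply/bigmax_leP; split => /=.
  exact: sqrtr_ge0.
move=> [i j] _ /=; rewrite ord1 -sqrtr_sqr ler_sqrt.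
  rewrite /dot (bigD1 j)//= expr2 lerDl sumr_ge0// => k _.
  by rewrite -expr2 sqr_ge0.
by rewrite sumr_ge0// => k _; rewrite -expr2 sqr_ge0.
Qed.

(** A crude Cauchy-Schwarz inequality for the sup norm, which is the norm behind
    differentials and neighbourhoods. *)
Lemma dot_norm_le (R : realType) n (x y : 'rV[R]_n) :
  `|dot x y| <= n%:R * (`|x| * `|y|).
Proof.
apply: (le_trans (ler_norm_sum _ _ _)).
have -> : n%:R * (`|x| * `|y|) = \sum_(i < n) `|x| * `|y|.
  by rewrite sumr_const card_ord mulr_natl.
by apply: ler_sum => i _; rewrite normrM ler_pM// ler_coord_norm.
Qed.

Lemma dot_cvg (R : realType) n (T : Type) (F : set_system T) {FF : Filter F}
    (f g : T -> 'rV[R]_n) (x y : 'rV[R]_n) :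
  f @ F --> x -> g @ F --> y -> (fun t => dot (f t) (g t)) @ F --> dot x y.
Proof.
move=> fx gy; apply: cvg_big => [|i _]; first by move=> [a b]; apply: cvgD;
  [exact: cvg_fst|exact: cvg_snd].
have coord (h : T -> 'rV[R]_n) (z : 'rV[R]_n) :
    h @ F --> z -> (fun t => h t 0 i) @ F --> z 0 i.
  by move=> hz; apply: (@cvg_comp _ _ _ h (fun x : 'rV[R]_n => x 0 i) _ _ _ hz);
    exact: coord_continuous.
by apply: cvgM; exact: coord.
Qed.

Lemma enorm_continuous (R : realType) n : continuous (@enorm R n).
Proof.
move=> x; apply: (continuous_comp (f := fun x => dot x x) (g := Num.sqrt)).
  by apply: (@dot_cvg R n _ (nbhs x) _ id id); exact: cvg_id.
exact: sqrt_continuous.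
Qed.

Lemma compact_enorm_le (R : realType) n (M : R) :
  compact [set x : 'rV[R]_n | enorm x <= M].
Proof.
apply: bounded_closed_compact.
  exists M; split => [|N MN x /= xM]; first exact: num_real.
  exact: (le_trans (ler_norm_enorm _) (le_trans xM (ltW MN))).
apply: (closed_comp (f := @enorm R n) (D := [set r | r <= M])).
  by move=> x _; exact: enorm_continuous.
exact: closed_le.
Qed.

Lemma enorm0 (R : realType) n : enorm (0 : 'rV[R]_n) = 0.
Proof. by rewrite /enorm dot0r sqrtr0. Qed.

(** * Differentials from one-sided bounds *)

(** The bound gives f (y + h e) - f y >= h g_i (y + h e) for both signs of h.
    Dividing by h and letting h tend to 0 from either side yields the two
    inequalities between the partial derivative and g_i y.  Letting g vary with
    z, rather than be a fixed subgradient at y, is what handles a minorant that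
    is itself only known through its slopes. *)
Lemma grad_eq_of_minorant (R : realType) n (f : 'rV[R]_n -> R)
    (g : 'rV[R]_n -> 'rV[R]_n) (y : 'rV[R]_n) :
  differentiable f y -> {for y, continuous g} ->
  (forall z, dot (g z) (z - y) <= f z - f y) -> grad f y = g y.
Proof.
move=> df cg minor; apply/rowP => i; rewrite mxE; set e := delta_mx 0 i.
pose quot h := h^-1 *: ((f \o shift y) (h *: e) - f y).
have quot_cvg : quot @ 0^' --> 'D_e f y by exact: diff_derivable.
have line_cvg : (fun h : R => h *: e + y) @ 0 --> y.
  have -> : nbhs y = nbhs (0 *: e + y) by rewrite scale0r add0r.
  by apply: cvgD; [apply: cvgZr_tmp; exact: cvg_id|exact: cvg_cst].
have gi_cvg : (fun h : R => g (h *: e + y) 0 i) @ 0 --> g y 0 i.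
  apply: (@cvg_comp _ _ _ (fun h : R => g (h *: e + y))
    (fun x : 'rV[R]_n => x 0 i) _ _ _ _ (@coord_continuous _ _ _ 0 i (g y))).
  exact: (cvg_comp _ _ line_cvg cg).
have minor_line h : h * g (h *: e + y) 0 i <= f (h *: e + y) - f y.
  by have := minor (h *: e + y); rewrite addrK dotZr dot_delta.
apply/eqP; rewrite eq_le; apply/andP; split.
  apply: (ler_cvg_to (cvg_dnbhs_at_left quot_cvg) (cvg_at_left_filter gi_cvg)).
  near=> h.
  have h_lt0 : h < 0 by near: h; exact: nbhs_left_lt.
  by rewrite /quot /= /GRing.scale/= ler_ndivrMl// mulrC.
apply: (ler_cvg_to (cvg_at_right_filter gi_cvg) (cvg_dnbhs_at_right quot_cvg)).
near=> h.
have h_gt0 : 0 < h by near: h; exact: nbhs_right_gt.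
by rewrite /quot /= /GRing.scale/= ler_pdivlMl.
Unshelve. all: by end_near. Qed.

Lemma diff_of_remainder (R : realType) (V W : normedModType R) (f : V -> W)
    (df : {linear V -> W}) (x : V) : continuous df ->
  (forall e : R, 0 < e ->
    \forall q \near x, `|f q - f x - df (q - x)| <= e * `|q - x|) ->
  differentiable f x /\ 'd f x = df :> (V -> W).
Proof.
move=> dfc rem_le.
suff expansion : f \o shift x = cst (f x) + df +o_ 0 id.
  have dE := diff_unique dfc expansion.
  by split=> //; apply/diff_locallyP; rewrite dE.
apply/eqaddoP => e e_gt0; have := rem_le e e_gt0.
rewrite (near_shift 0 x) subr0 /=; apply: filterS => h /=.
by rewrite addrK opprD addrA.
Qed.

(** The inner product on space-time, which represents the linear forms on
    R * 'rV[R]_n by their coefficients. *)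
Definition pdot (R : realType) n (a b : R * 'rV[R]_n) : R :=
  a.1 * b.1 + dot a.2 b.2.

Lemma pdotDl (R : realType) n (a b c : R * 'rV[R]_n) :
  pdot (a + b) c = pdot a c + pdot b c.
Proof. by rewrite /pdot/= mulrDl dotDl; ring. Qed.

Lemma pdotNl (R : realType) n (a b : R * 'rV[R]_n) : pdot (- a) b = - pdot a b.
Proof. by rewrite /pdot/= mulNr dotC dotNr dotC; ring. Qed.

Lemma pdotNr (R : realType) n (a b : R * 'rV[R]_n) : pdot a (- b) = - pdot a b.
Proof. by rewrite /pdot/= mulrN dotNr; ring. Qed.

Fact pdot_is_linear (R : realType) n (a : R * 'rV[R]_n) :
  linear (pdot a : _ -> R).
Proof.
by move=> k b c; rewrite /pdot/= dotDr dotZr /GRing.scale/=; ring.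
Qed.

HB.instance Definition _ (R : realType) n (a : R * 'rV[R]_n) :=
  GRing.isLinear.Build R (R * 'rV[R]_n)%type R *:%R (pdot a)
    (@pdot_is_linear R n a).

Lemma pdot_norm_le (R : realType) n (a b : R * 'rV[R]_n) :
  `|pdot a b| <= n.+1%:R * (`|a| * `|b|).
Proof.
rewrite (le_trans (ler_normD _ _))// -natr1 mulrDl mul1r addrC lerD//.
  rewrite (le_trans (dot_norm_le _ _))// ler_wpM2l//.
  by apply: ler_pM => //; rewrite prod_normE le_max lexx orbT.
by rewrite normrM; apply: ler_pM => //; rewrite prod_normE le_max lexx.
Qed.

Lemma pdot_cvg (R : realType) n (T : Type) (F : set_system T) {FF : Filter F}
    (f g : T -> R * 'rV[R]_n) (x y : R * 'rV[R]_n) :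
  f @ F --> x -> g @ F --> y -> (fun t => pdot (f t) (g t)) @ F --> pdot x y.
Proof.
move=> fx gy; apply: cvgD; [apply: cvgM|apply: dot_cvg].
- exact: (cvg_comp _ _ fx cvg_fst).
- exact: (cvg_comp _ _ gy cvg_fst).
- exact: (cvg_comp _ _ fx cvg_snd).
- exact: (cvg_comp _ _ gy cvg_snd).
Qed.

(** A function with sub- and super-slopes that depend on the moving point q
    is differentiable at a as soon as both slopes have the same limit: the
    remainder is at most |slope - l| |q - a| up to a constant. *)
Lemma diff_of_sandwich (R : realType) n (u : R * 'rV[R]_n -> R)
    (A B : R * 'rV[R]_n -> R * 'rV[R]_n) (a l : R * 'rV[R]_n) :
  A @ a --> l -> B @ a --> l ->
  (\forall q \near a,
     pdot (B q) (q - a) <= u q - u a <= pdot (A q) (q - a)) ->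
  differentiable u a /\ 'd u a = pdot l :> (_ -> R).
Proof.
move=> Al Bl sandwich.
have lc : continuous (pdot l : _ -> R).
  by move=> q; apply: (@pdot_cvg R n _ (nbhs q) _ (cst l) id);
    [exact: cvg_cst|exact: cvg_id].
apply: diff_of_remainder => // _/posnumP[e].
(* n.+1 is the constant of pdot_norm_le *)
pose d := e%:num / n.+1%:R.
have d_gt0 : 0 < d by rewrite divr_gt0.
near=> q.
have := near sandwich q; move=> /(_ _)/andP[]// lower upper.
have closeA : `|A q - l| <= d by near: q; apply: cvgr_distC_le.
have closeB : `|B q - l| <= d by near: q; apply: cvgr_distC_le.
have bound (b : R * 'rV[R]_n) : `|b - l| <= d ->
    `|pdot b (q - a) - pdot l (q - a)| <= e%:num * `|q - a|.
  move=> bl; rewrite -pdotNl -pdotDl (le_trans (pdot_norm_le _ _))//.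
  rewrite mulrA ler_wpM2r// mulrC -ler_pdivlMr//.
move: (bound _ closeA) (bound _ closeB); rewrite !ler_norml.
by move=> /andP[? ?] /andP[? ?]; apply/andP; split; lra.
Unshelve. all: by end_near. Qed.

(** * The Fenchel conjugate *)

Lemma set_max_eq (R : realType) (A : set R) (a : R) :
  A a -> ubound A a -> set_max A = a.
Proof.
move=> Aa ub_a; apply: xget_unique => // b [Ab ub_b].
by apply/eqP; rewrite eq_le ub_a// ub_b.
Qed.

Lemma set_min_eq (R : realType) (A : set R) (a : R) :
  A a -> lbound A a -> set_min A = a.
Proof.
move=> Aa lb_a; apply: xget_unique => // b [Ab lb_b].
by apply/eqP; rewrite eq_le lb_a// lb_b.
Qed.

(** Outside a ball that is uniform in the bounded z, the concave function
    q |-> dot z q - H q lies below its value at 0.  This serves both to attain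
    the supremum and to confine its maximisers when z varies. *)
Lemma superlinear_coercive (R : realType) n (H : 'rV[R]_n -> R) (r : R) :
  superlinear H -> exists2 M, 0 <= M & forall z p : 'rV[R]_n,
    `|z| <= r -> M < enorm p -> dot z p - H p < - H 0.
Proof.
(* n%:R * r bounds the growth of dot z; the extra 1 leaves a margin enorm p,
   which exceeds H 0 *)
move=> /(_ (n%:R * r + 1))[B HB]; exists (Num.max B (Num.max 0 (H 0))).
  by rewrite !le_max lexx orbT.
move=> z p zr; rewrite !gt_max => /and3P[Bp p_gt0 H0p].
have := HB p Bp; rewrite ltr_pdivlMr// => Hp.
have dot_le : dot z p <= n%:R * r * enorm p.
  rewrite (le_trans (ler_norm _))// (le_trans (dot_norm_le _ _))//.
  by rewrite -mulrA ler_wpM2l// ler_pM// ler_norm_enorm.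
by move: Hp; rewrite mulrDl mul1r; lra.
Qed.

(** The gradient of the conjugate at z, obtained as the point where the supremum
    defining the conjugate is attained. *)
Definition conj_slope (R : realType) n (H : 'rV[R]_n -> R) (z : 'rV[R]_n) :=
  xget 0 [set p | forall q, dot z q - H q <= dot z p - H p].

Section Conjugate.
Context (R : realType) (n : nat) (H : 'rV[R]_n -> R).
Hypothesis H_diff : forall p, differentiable H p.
Hypothesis H_H0 : hypH0 H.
Implicit Types z p q w : 'rV[R]_n.

Let H_cvg p : H @ p --> H p.
Proof. exact: differentiable_continuous. Qed.

Lemma conj_slope_max z q :
  dot z q - H q <= dot z (conj_slope H z) - H (conj_slope H z).
Proof.
suff [p pmax] : exists p, forall q, dot z q - H q <= dot z p - H p.
  have := @xgetPex _ 0 [set p | forall q, dot z q - H q <= dot z p - H p].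
  by apply; exists p.
have [M M_ge0 coercive] := superlinear_coercive `|z| H_H0.2.
have [||p _ pmin] := @compact_EVT_min _ R (fun q => H q - dot z q)
  _ _ (@compact_enorm_le R n M).
- by exists 0 => /=; rewrite enorm0.
- apply: continuous_subspaceT => p.
  apply: (cvgB (@H_cvg p)).
  by apply: (@dot_cvg R n _ (nbhs p) _ (cst z) id);
    [exact: cvg_cst|exact: cvg_id].
have min0 : H p - dot z p <= H 0.
  by have := pmin 0; rewrite dot0r subr0; apply; rewrite inE /= enorm0.
exists p => r; have [rM|Mr] := leP (enorm r) M.
  by rewrite -lerN2 !opprB; apply: pmin; rewrite inE.
by have := coercive z r (lexx _) Mr; lra.
Qed.

(** Strict convexity excludes two maximisers, by their midpoint. *)
Lemma conj_slope_unique z p :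
  (forall q, dot z q - H q <= dot z p - H p) -> p = conj_slope H z.
Proof.
move=> pmax; have [//|neq_p] := eqVneq p (conj_slope H z).
have half : 0 < (2^-1 : R) < 1 by apply/andP; split; lra.
have := H_H0.1; move=> /(_ p (conj_slope H z) 2^-1 neq_p half).
have := conj_slope_max z (2^-1 *: p + (1 - 2^-1) *: conj_slope H z).
have := pmax (conj_slope H z); rewrite dotDr !dotZr => *.
by exfalso; clear neq_p; lra.
Qed.

Lemma conj_slope_continuous : continuous (conj_slope H).
Proof.
move=> z.
have [M M_ge0 coercive] := superlinear_coercive (`|z| + 1) H_H0.2.
have f_cvg p : {for (z, p), continuous
    (fun a : 'rV[R]_n * 'rV[R]_n => H a.2 - dot a.1 a.2)}.
  apply: cvgB; first exact: (cvg_comp _ _ cvg_snd (@H_cvg p)).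
  by apply: (@dot_cvg R n _ (nbhs (z, p)) _ fst snd);
    [exact: cvg_fst|exact: cvg_snd].
apply: (@continuous_argmin _ _ _ _ _ (conj_slope H) z
  (@compact_enorm_le R n M) (f_cvg _) (fun p _ => f_cvg p)) => /=.
- move=> p _ /eqP neq_p; rewrite lt_neqAle; apply/andP; split.
    apply/eqP => eq_p; case/eqP: neq_p; apply: conj_slope_unique => q.
    by have := conj_slope_max z q; lra.
  by have := conj_slope_max z p; lra.
near=> w; split; last by have := conj_slope_max w (conj_slope H z); lra.
rewrite leNgt; apply/negP => /(coercive w) lt0.
have : dot w (conj_slope H w) - H (conj_slope H w) < - H 0.
  apply: lt0; near: w.
  by apply: cvgr_norm_le; [exact: cvg_id|rewrite ltrDl].
by have := conj_slope_max w 0; rewrite dot0r; lra.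
Unshelve. all: by end_near. Qed.

Lemma fenchelE z :
  fenchel H z = dot z (conj_slope H z) - H (conj_slope H z).
Proof.
apply: set_max_eq; first by exists (conj_slope H z).
by move=> _ [q _ <-]; exact: conj_slope_max.
Qed.

Lemma fenchel_continuous : continuous (fenchel H).
Proof.
move=> z; have slope_cvg := @conj_slope_continuous z.
have -> : fenchel H = fun w => dot w (conj_slope H w) - H (conj_slope H w).
  by apply/funext => w; exact: fenchelE.
have dot_slope_cvg :
    (fun w => dot w (conj_slope H w)) @ z --> dot z (conj_slope H z).
  by apply: (@dot_cvg R n _ (nbhs z) _ id (conj_slope H));
    [exact: cvg_id|exact: slope_cvg].
exact: (cvgB dot_slope_cvg (cvg_comp _ _ slope_cvg (@H_cvg _))).
Qed.

(** The gradient of H inverts the slope of the conjugate: the concave function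
    q |-> dot z q - H q is critical at its maximiser. *)
Lemma grad_conj_slope z : grad H (conj_slope H z) = z.
Proof.
apply: (grad_eq_of_minorant (g := cst z)) => //; first exact: cst_continuous.
by move=> p /=; have := conj_slope_max z p; rewrite dotBr; lra.
Qed.

(** The perspective (t, w) |-> t * fenchel H (w / t), the least cost of the
    displacement w in time t, is the supremum over p of the linear forms
    dot w p - t * H p.  The next facts all come from this description. *)
Lemma perspective_ge (t : R) w p : 0 < t ->
  dot w p - t * H p <= t * fenchel H (t^-1 *: w).
Proof.
move=> t_gt0; have := conj_slope_max (t^-1 *: w) p.
rewrite -fenchelE -(ler_pM2l t_gt0) mulrBr dotZl mulrA divff ?gt_eqF//.
by rewrite mul1r.
Qed.

Lemma perspectiveE (t : R) w : 0 < t ->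
  t * fenchel H (t^-1 *: w)
  = dot w (conj_slope H (t^-1 *: w)) - t * H (conj_slope H (t^-1 *: w)).
Proof.
move=> t_gt0; rewrite fenchelE mulrBr dotZl mulrA divff ?gt_eqF//.
by rewrite mul1r.
Qed.

(** A sublinear function is subadditive: splitting a displacement in two legs
    never lowers the cost. *)
Lemma perspective_subadditive (s t : R) (v w : 'rV[R]_n) : 0 < s -> 0 < t ->
  (s + t) * fenchel H ((s + t)^-1 *: (v + w))
  <= s * fenchel H (s^-1 *: v) + t * fenchel H (t^-1 *: w).
Proof.
move=> s_gt0 t_gt0; rewrite perspectiveE ?addr_gt0//; set p := conj_slope H _.
have := lerD (perspective_ge v p s_gt0) (perspective_ge w p t_gt0).
by rewrite dotDl mulrDl; lra.
Qed.

(** The space-time gradient of the perspective at any (t, w) with w / t = z. *)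
Definition cost_slope z := (- H (conj_slope H z), conj_slope H z).

Lemma cost_slope_continuous : continuous cost_slope.
Proof.
move=> z; have slope_cvg := @conj_slope_continuous z.
have H_slope_cvg : (fun w => H (conj_slope H w)) @ z --> H (conj_slope H z).
  exact: (cvg_comp _ _ slope_cvg (@H_cvg _)).
exact: (cvg_pair (cvgN H_slope_cvg) slope_cvg).
Qed.

(** The form that attains the supremum at (t, w) is a competitor at (s, v). *)
Lemma perspective_sub_le (s t : R) (v w : 'rV[R]_n) : 0 < s -> 0 < t ->
  t * fenchel H (t^-1 *: w) - s * fenchel H (s^-1 *: v)
  <= pdot (cost_slope (t^-1 *: w)) (t - s, w - v).
Proof.
move=> s_gt0 t_gt0; rewrite perspectiveE// /pdot/=.
set p := conj_slope H _; have := perspective_ge v p s_gt0.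
by rewrite dotBr (dotC p w) (dotC p v); lra.
Qed.

End Conjugate.

(** * Minimisers of the Hopf-Lax formula *)

Lemma velocity_cvg (R : realType) n (T : Type) (F : set_system T)
    {FF : Filter F} (s : T -> R) (f g : T -> 'rV[R]_n) (t : R)
    (x y : 'rV[R]_n) : t != 0 ->
  s @ F --> t -> f @ F --> x -> g @ F --> y ->
  (fun e => (s e)^-1 *: (f e - g e)) @ F --> t^-1 *: (x - y).
Proof. by move=> t0 st fx gy; apply: cvgZ; [exact: cvgV|exact: cvgB]. Qed.

Section HopfLax.
Context (R : realType) (n : nat) (T : R) (H sigma : 'rV[R]_n -> R).
Hypothesis H_diff : forall p, differentiable H p.
Hypothesis sigma_diff : forall y, differentiable sigma y.
Hypothesis H_H0 : hypH0 H.
Hypothesis H_H1 : hypH1 T H sigma.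
Implicit Types (t : R) (x y z : 'rV[R]_n) (q a : R * 'rV[R]_n).

Local Notation cost := (hopf_lax_cost H sigma).

Definition minimiser t x y := forall z, cost t x y <= cost t x z.

Lemma cost_continuous a y : 0 < a.1 ->
  {for (a, y), continuous (fun b : (R * 'rV[R]_n) * 'rV[R]_n =>
    cost b.1.1 b.1.2 b.2)}.
Proof.
move=> a_gt0.
have time_cvg : (fun b : (R * 'rV[R]_n) * 'rV[R]_n => b.1.1) @ (a, y) --> a.1.
  exact: (cvg_comp _ _ cvg_fst cvg_fst).
have pos_cvg : (fun b : (R * 'rV[R]_n) * 'rV[R]_n => b.1.2) @ (a, y) --> a.2.
  exact: (cvg_comp _ _ cvg_fst cvg_snd).
have foot_cvg : (fun b : (R * 'rV[R]_n) * 'rV[R]_n => b.2) @ (a, y) --> y.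
  exact: cvg_snd.
have sigma_cvg : (fun b : (R * 'rV[R]_n) * 'rV[R]_n => sigma b.2) @ (a, y)
    --> sigma y.
  exact: (cvg_comp _ _ foot_cvg (differentiable_continuous (sigma_diff y))).
have a_neq0 : a.1 != 0 by rewrite gt_eqF.
have fenchel_cvg : (fun b : (R * 'rV[R]_n) * 'rV[R]_n =>
    fenchel H (b.1.1^-1 *: (b.1.2 - b.2))) @ (a, y)
    --> fenchel H (a.1^-1 *: (a.2 - y)).
  exact: (cvg_comp _ _ (velocity_cvg a_neq0 time_cvg pos_cvg foot_cvg)
    (@fenchel_continuous R n H H_diff H_H0 _)).
exact: (cvgD sigma_cvg (cvgM time_cvg fenchel_cvg)).
Qed.

Lemma cost_sub_le a q z : 0 < a.1 -> 0 < q.1 ->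
  cost q.1 q.2 z - cost a.1 a.2 z
  <= pdot (cost_slope H (q.1^-1 *: (q.2 - z))) (q - a).
Proof.
move=> a_gt0 q_gt0; rewrite /hopf_lax_cost opprD addrACA subrr add0r.
have -> : q - a = (q.1 - a.1, (q.2 - z) - (a.2 - z)).
  by congr (_, _); rewrite /= opprB addrA subrK.
exact: perspective_sub_le.
Qed.

(** (H1) compares every point outside a ball with the minimum over the ball, for
    all parameters near a; on the ball, compactness gives a minimiser, which is
    therefore global. *)
Lemma minimisers_confined a : 0 < a.1 < T ->
  exists N, \forall q \near a, (exists y, minimiser q.1 q.2 y) /\
    (forall y, minimiser q.1 q.2 y -> enorm y <= N).
Proof.
move=> /andP[a_gt0 a_ltT].
have [|r [N [r_gt0 N_gt0 outside]]] := H_H1.2 a.1 a.2.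
  by rewrite ltW.
exists N; near=> q.
have q_gt0 : 0 < q.1.
  by near: q; apply: (cvgr_gt a.1) => //; exact: cvg_fst.
have q_ltT : q.1 < T.
  by near: q; apply: (cvgr_lt a.1) => //; exact: cvg_fst.
have q_near : `|q.1 - a.1| + enorm (q.2 - a.2) < r.
  near: q; apply: (cvgr_lt 0) => //.
  have time_cvg : (fun q : R * 'rV[R]_n => `|q.1 - a.1|) @ a --> 0.
    have fst_cvg : (fun q => q.1) @ a --> a.1 by exact: cvg_fst.
    have sub_cvg : (fun q => q.1 - a.1) @ a --> a.1 - a.1.
      exact: (cvgB fst_cvg (cvg_cst a.1)).
    have -> : 0 = `|a.1 - a.1| by rewrite subrr normr0.
    exact: (cvg_norm sub_cvg).
  have pos_cvg : (fun q : R * 'rV[R]_n => enorm (q.2 - a.2)) @ a --> 0.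
    have snd_cvg : (fun q => q.2) @ a --> a.2 by exact: cvg_snd.
    have sub_cvg : (fun q => q.2 - a.2) @ a --> a.2 - a.2.
      exact: (cvgB snd_cvg (cvg_cst a.2)).
    have -> : 0 = enorm (a.2 - a.2) by rewrite subrr enorm0.
    exact: (cvg_comp _ _ sub_cvg (@enorm_continuous R n (a.2 - a.2))).
  have sum_cvg := cvgD time_cvg pos_cvg.
  by rewrite addr0 in sum_cvg; exact: sum_cvg.
have q_in : 0 < q.1 < T by rewrite q_gt0.
have [||y yN ymin] := @compact_EVT_min _ R (cost q.1 q.2) _ _
  (@compact_enorm_le R n N).
- by exists 0 => /=; rewrite enorm0 ltW.
- apply: continuous_subspaceT => y.
  by apply: (cvg_comp _ _ (cvg_pair (cvg_cst q) cvg_id)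
    (@cost_continuous q y q_gt0)).
have outside_lt z : N < enorm z -> cost q.1 q.2 y < cost q.1 q.2 z.
  move=> /outside/(_ q_in q_near).
  rewrite (@set_min_eq _ _ (cost q.1 q.2 y))//.
    by exists y => //; rewrite inE in yN.
  by move=> _ [w wN <-]; apply: ymin; rewrite inE.
have y_min : minimiser q.1 q.2 y.
  move=> z; have [zN|/outside_lt/ltW//] := leP (enorm z) N.
  by apply: ymin; rewrite inE.
split; first by exists y.
move=> z z_min; rewrite leNgt; apply/negP => /outside_lt.
by rewrite ltNge z_min.
Unshelve. all: by end_near. Qed.

Definition foot q := xget 0 (minimiser q.1 q.2).

Lemma foot_min q : 0 < q.1 < T -> minimiser q.1 q.2 (foot q).
Proof.
move=> /minimisers_confined[N /nbhs_singleton[ex_min _]].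
exact: (@xgetPex _ 0 (minimiser q.1 q.2) ex_min).
Qed.

Lemma hopf_laxE t x y : minimiser t x y -> hopf_lax H sigma t x = cost t x y.
Proof.
move=> y_min; apply: set_min_eq; first by exists y.
by move=> _ [z _ <-].
Qed.

(** Minimality of y bounds sigma z - sigma y below by the decrease of the
    perspective, hence by a slope at z. *)
Lemma minimiser_grad t x y : 0 < t -> minimiser t x y ->
  grad sigma y = conj_slope H (t^-1 *: (x - y)).
Proof.
move=> t_gt0 y_min.
apply: (grad_eq_of_minorant
  (g := fun z => conj_slope H (t^-1 *: (x - z)))) => //.
  have arg_cvg : (fun z => t^-1 *: (x - z)) @ y --> t^-1 *: (x - y).
    apply: (@velocity_cvg R n _ (nbhs y) _ (cst t) (cst x) id).
    - by rewrite gt_eqF.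
    - exact: cvg_cst.
    - exact: cvg_cst.
    - exact: cvg_id.
  exact: (cvg_comp _ _ arg_cvg (@conj_slope_continuous R n H H_diff H_H0 _)).
move=> z.
have := y_min z; rewrite /hopf_lax_cost.
have := perspective_sub_le H_diff H_H0 (x - y) (x - z) t_gt0 t_gt0.
by rewrite /pdot/= subrr mulr0 add0r !dotBr; lra.
Qed.

Lemma minimiser_characteristic t x y : 0 < t -> minimiser t x y ->
  y + t *: grad H (grad sigma y) = x.
Proof.
move=> t_gt0 y_min; rewrite (minimiser_grad t_gt0 y_min).
rewrite grad_conj_slope// scalerA divff ?gt_eqF// scale1r.
by rewrite addrC subrK.
Qed.

(** Let x = y + s v be the point reached at time s on the line from y.
    From z to x and then along the line to time t costs at most as much as going
    along the line from y, since z is optimal at (s, x); the direct path from z is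
    no more expensive than this detour. *)
Lemma minimiser_persists s t v y z : 0 < s < t ->
  minimiser t (y + t *: v) y -> minimiser s (y + s *: v) z ->
  minimiser t (y + t *: v) z.
Proof.
move=> /andP[s_gt0 lt_st] y_min z_min w; apply: le_trans (y_min w).
have ts_gt0 : 0 < t - s by rewrite subr_gt0.
have t_gt0 : 0 < t by exact: lt_trans lt_st.
have := perspective_subadditive H_diff H_H0 (y + s *: v - z) ((t - s) *: v)
  s_gt0 ts_gt0.
have -> : s + (t - s) = t by ring.
have -> : y + s *: v - z + (t - s) *: v = y + t *: v - z.
  by rewrite addrAC -[in LHS](addrA y) -scalerDl addrC [s + _]addrC subrK addrC.
have line r : 0 < r -> r^-1 *: (y + r *: v - y) = v.
  by move=> r0; rewrite addrAC subrr add0r scalerA mulVf ?gt_eqF// scale1r.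
rewrite scalerA mulVf ?gt_eqF// scale1r.
have := z_min y; rewrite /hopf_lax_cost !line//.
by rewrite mulrBl; lra.
Qed.

(** * Injective characteristics and regularity *)

Section Injective.
Variable tstar : R.
Hypothesis tstar_in : 0 < tstar < T.
Hypothesis x_inj : injective (fun y => y + tstar *: grad H (grad sigma y)).

(** The point at time tstar on the characteristic from y has some foot, whose
    characteristic leads to the same point; by injectivity that foot is y. *)
Lemma characteristic_optimal y :
  minimiser tstar (y + tstar *: grad H (grad sigma y)) y.
Proof.
have z_min := @foot_min (tstar, y + tstar *: grad H (grad sigma y)) tstar_in.
have /andP[tstar_gt0 _] := tstar_in.
have /x_inj footE := minimiser_characteristic tstar_gt0 z_min.
by rewrite footE in z_min.
Qed.

Lemma minimiser_unique t x y z : 0 < t < tstar ->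
  minimiser t x y -> minimiser t x z -> z = y.
Proof.
move=> t_in y_min z_min; have /andP[t_gt0 lt_t] := t_in.
have /andP[tstar_gt0 _] := tstar_in.
have xE := minimiser_characteristic t_gt0 y_min.
rewrite -xE in z_min.
have := minimiser_persists t_in (@characteristic_optimal y) z_min.
by move=> /(minimiser_characteristic tstar_gt0)/x_inj.
Qed.

Lemma foot_continuous a : 0 < a.1 < tstar -> {for a, continuous foot}.
Proof.
move=> a_in; have /andP[a_gt0 a_lt] := a_in.
have a_inT : 0 < a.1 < T.
  by rewrite a_gt0 (lt_trans a_lt)//; case/andP: tstar_in.
have [N confined] := minimisers_confined a_inT.
apply: (@continuous_argmin R _ _ (fun b => cost b.1.1 b.1.2 b.2) _ foot a
  (@compact_enorm_le R n N) (@cost_continuous a _ a_gt0)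
  (fun y _ => @cost_continuous a y a_gt0)) => /=.
- move=> y _ neq_y; rewrite lt_neqAle; apply/andP; split; last exact: foot_min.
  apply/eqP => eq_cost; apply: neq_y.
  apply: (minimiser_unique a_in (foot_min a_inT)) => z.
  by rewrite -eq_cost; exact: foot_min.
near=> q.
have [[y y_min] bound] : (exists y, minimiser q.1 q.2 y) /\
  (forall y, minimiser q.1 q.2 y -> enorm y <= N) by near: q.
have q_min : minimiser q.1 q.2 (foot q).
  by apply: (@xgetPex _ 0 (minimiser q.1 q.2)); exists y.
by split; [exact: bound|exact: q_min].
Unshelve. all: by end_near. Qed.

(** The velocity of the optimal characteristic through q. *)
Definition characteristic_velocity q := q.1^-1 *: (q.2 - foot q).

(** Bounding u q above by the cost from the foot of a, and u a above by the
    cost from the foot of q, gives super- and sub-slopes of u between a and q;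
    they merge because the foot is continuous. *)
Lemma diff_hopf_lax u a :
  (forall t x, 0 < t < T -> u (t, x) = hopf_lax H sigma t x) ->
  0 < a.1 < tstar ->
  differentiable u a /\
  'd u a = pdot (cost_slope H (characteristic_velocity a)) :> (_ -> R).
Proof.
move=> uE a_in; have /andP[a_gt0 a_lt] := a_in.
have a_inT : 0 < a.1 < T.
  by rewrite a_gt0 (lt_trans a_lt)//; case/andP: tstar_in.
have u_cost q : 0 < q.1 < T -> u q = cost q.1 q.2 (foot q).
  by case: q => t x q_in; rewrite uE//; exact/hopf_laxE/foot_min.
have a_neq0 : a.1 != 0 by rewrite gt_eqF.
have foot_cvg : foot @ a --> foot a by exact: foot_continuous.
have slopeC :=
  @cost_slope_continuous R n H H_diff H_H0 (characteristic_velocity a).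
have upper_cvg : (fun q => cost_slope H (q.1^-1 *: (q.2 - foot a))) @ a
    --> cost_slope H (characteristic_velocity a).
  exact: (cvg_comp _ _ (@velocity_cvg R n _ (nbhs a) _ fst snd (cst (foot a))
    _ _ _ a_neq0 cvg_fst cvg_snd (cvg_cst _)) slopeC).
have lower_cvg : (fun q => cost_slope H (a.1^-1 *: (a.2 - foot q))) @ a
    --> cost_slope H (characteristic_velocity a).
  exact: (cvg_comp _ _ (@velocity_cvg R n _ (nbhs a) _ (cst a.1) (cst a.2) foot
    _ _ _ a_neq0 (cvg_cst _) (cvg_cst _) foot_cvg) slopeC).
apply: (diff_of_sandwich upper_cvg lower_cvg).
near=> q.
have q_gt0 : 0 < q.1.
  by near: q; apply: (cvgr_gt a.1) => //; exact: cvg_fst.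
have q_ltT : q.1 < T.
  by near: q; apply: (cvgr_lt a.1); [exact: cvg_fst|case/andP: a_inT].
have q_inT : 0 < q.1 < T by rewrite q_gt0.
rewrite !u_cost//; apply/andP; split.
  rewrite -lerN2 -pdotNr !opprB; apply: le_trans (cost_sub_le _ q_gt0 a_gt0).
  by rewrite lerD2r; exact: foot_min.
apply: le_trans (cost_sub_le _ a_gt0 q_gt0).
by rewrite lerD2r; exact: foot_min.
Unshelve. all: by end_near. Qed.

Lemma characteristic_velocity_continuous a :
  0 < a.1 < tstar -> {for a, continuous characteristic_velocity}.
Proof.
move=> a_in; have /andP[a_gt0 _] := a_in.
apply: (@velocity_cvg R n _ (nbhs a) _ fst snd foot).
- by rewrite gt_eqF.
- exact: cvg_fst.
- exact: cvg_snd.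
- exact: foot_continuous.
Qed.

Lemma continuous_diff_hopf_lax u v a :
  (forall t x, 0 < t < T -> u (t, x) = hopf_lax H sigma t x) ->
  0 < a.1 < tstar -> {for a, continuous (fun q => 'd u q v : R)}.
Proof.
move=> uE a_in; have /andP[a_gt0 a_lt] := a_in.
have momentum_cvg : (fun q => cost_slope H (characteristic_velocity q)) @ a
    --> cost_slope H (characteristic_velocity a).
  exact: (cvg_comp _ _ (characteristic_velocity_continuous a_in)
    (@cost_slope_continuous R n H H_diff H_H0 _)).
have formula_cvg :
    (fun q => pdot (cost_slope H (characteristic_velocity q)) v) @ a -->
    pdot (cost_slope H (characteristic_velocity a)) v.
  exact: (@pdot_cvg R n _ (nbhs a) _ _ (cst v) _ _ momentum_cvg (cvg_cst v)).
have time_cvg : (fun q => q.1) @ a --> a.1 by exact: cvg_fst.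
have duE : \forall q \near a,
    pdot (cost_slope H (characteristic_velocity q)) v = 'd u q v :> R.
  apply: filterS2 (cvgr_gt _ time_cvg _ a_gt0) (cvgr_lt _ time_cvg _ a_lt).
  by move=> q q_gt0 q_lt; rewrite (diff_hopf_lax uE _).2// q_gt0.
have du_cvg := cvg_trans (@near_eq_cvg _ _ (nbhs a) _ _ _ duE) formula_cvg.
rewrite -(diff_hopf_lax uE a_in).2 in du_cvg; exact: du_cvg.
Qed.

End Injective.
End HopfLax.

Theorem theorem4p1 (R : realType) (n : nat) (T : R)
    (H sigma : 'rV[R]_n -> R) (u : R * 'rV[R]_n -> R)
    (T_gt0 : 0 < T)
    (H_diff : forall p : 'rV[R]_n, differentiable H p)
    (sigma_diff : forall y : 'rV[R]_n, differentiable sigma y)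
    (H0 : hypH0 H)
    (H1 : hypH1 T H sigma)
    (u_visc : viscosity_solution T H sigma u)
    (u_hopf_lax : forall (t : R) (x : 'rV[R]_n),
       0 < t < T -> u (t, x) = hopf_lax H sigma t x)
    (tstar : R) (tstar_in : 0 < tstar < T)
    (x_inj : injective (fun y : 'rV[R]_n =>
       y + tstar *: grad H (grad sigma y))) :
  continuously_differentiable_on (strip n tstar) u.
Proof.
split=> [a a_in|v a]; first exact: (diff_hopf_lax H_diff sigma_diff H0 H1
  tstar_in x_inj u_hopf_lax a_in).1.
rewrite inE => a_in.
exact: (continuous_diff_hopf_lax H_diff sigma_diff H0 H1 tstar_in x_inj
  u_hopf_lax a_in).
Qed.
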